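(* Let $\mathbb{X}$ be a real normed linear space. (i) Suppose $\dim(\mathbb{X})=2$. If $\mathbb{X}$ is $\rho$-symmetric, then $\mathbb{X}$ is a Radon plane. (ii) Suppose $\dim(\mathbb{X})\ge 3$. Then $\mathbb{X}$ is $\rho$-symmetric if and only if $\mathbb{X}$ is an inner product space.
   Context: All normed spaces are real. Norm derivatives: $\rho'_{\pm}(x,y)=\|x\|\lim_{t\to 0^{\pm}}\frac{\|x+ty\|-\|x\|}{t}$ and $\rho'(x,y)=\frac12(\rho'_+(x,y)+\rho'_-(x,y))$. $\rho$-orthogonality: $x\perp_\rho y$ means $\rho'(x,y)=0$. The space $\mathbb{X}$ is $\rho$-symmetric if for all $x,y\in\mathbb{X}$, $x\perp_\rho y$ implies $y\perp_\rho x$. Birkhoff-James orthogonality: $x\perp_B y$ means $\|x+\lambda y\|\ge\|x\|$ for all $\lambda\in\mathbb{R}$. A Radon plane is a two-dimensional Banach space in which Birkhoff-James orthogonality is symmetric, i.e. $x\perp_B y$ implies $y\perp_B x$ for all $x,y$. ''$\mathbb{X}$ is an inner product space'' means that its norm is induced by an inner product. *)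

(* Defs.v *)
From mathcomp Require Import all_boot all_order all_algebra.
From mathcomp Require Import all_classical all_reals all_analysis.

Set Implicit Arguments.
Unset Strict Implicit.
Unset Printing Implicit Defensive.

Import Order.TTheory GRing.Theory Num.Theory.
Import numFieldNormedType.Exports.

Local Open Scope classical_set_scope.
Local Open Scope ring_scope.

(* [free] and [\dim] require a [vectType], that is a finite-dimensional space
   with chosen coordinates, so the dimension of an arbitrary real vector space
   is expressed here through bases. *)
Definition linearly_independent (R : realType) (X : lmodType R) (n : nat)
    (e : 'I_n -> X) : Prop :=
  forall a : 'I_n -> R, \sum_(i < n) a i *: e i = 0 -> forall i, a i = 0.

Definition spanning (R : realType) (X : lmodType R) (n : nat)
    (e : 'I_n -> X) : Prop :=
  forall x : X, exists a : 'I_n -> R, x = \sum_(i < n) a i *: e i.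

Definition has_dim (R : realType) (X : lmodType R) (n : nat) : Prop :=
  exists e : 'I_n -> X, linearly_independent e /\ spanning e.

(* Infinite-dimensional spaces satisfy [dim_ge X n] for every [n]. *)
Definition dim_ge (R : realType) (X : lmodType R) (n : nat) : Prop :=
  exists e : 'I_n -> X, linearly_independent e.

(* The one-sided limits always exist, because the norm is convex, so the
   default value of [lim] plays no role. *)
Definition rho_plus (R : realType) (X : normedModType R) (x y : X) : R :=
  `|x| * lim ((`|x + t *: y| - `|x|) / t @[t --> (0 : R)^'+]).

Definition rho_minus (R : realType) (X : normedModType R) (x y : X) : R :=
  `|x| * lim ((`|x + t *: y| - `|x|) / t @[t --> (0 : R)^'-]).

Definition rho (R : realType) (X : normedModType R) (x y : X) : R :=
  2^-1 * (rho_plus x y + rho_minus x y).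

Definition rho_orthogonal (R : realType) (X : normedModType R) (x y : X) :
  Prop := rho x y = 0.

Definition rho_symmetric (R : realType) (X : normedModType R) : Prop :=
  forall x y : X, rho_orthogonal x y -> rho_orthogonal y x.

Definition BJ_orthogonal (R : realType) (X : normedModType R) (x y : X) :
  Prop := forall l : R, `|x| <= `|x + l *: y|.

Definition BJ_symmetric (R : realType) (X : normedModType R) : Prop :=
  forall x y : X, BJ_orthogonal x y -> BJ_orthogonal y x.

(* The axiom of [completeType] as a property of [X]. *)
Definition is_banach (R : realType) (X : normedModType R) : Prop :=
  forall F : set_system X, ProperFilter F -> cauchy F -> cvg F.

Definition radon_plane (R : realType) (X : normedModType R) : Prop :=
  [/\ has_dim X 2, is_banach X & BJ_symmetric X].

(* Over a real field, [{dot X for idfun}] is the type of symmetric positive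
   definite bilinear forms on [X]. *)
Definition is_inner_product_space (R : realType) (X : normedModType R) : Prop :=
  exists form : {dot X for idfun}, forall x : X, `|x| = Num.sqrt (form x x).

(* Main.v *)
(* The norm derivative [rho x] is homogeneous and satisfies
   [rho x (y + s x) = rho x y + s |x|^2], so [x] is rho-orthogonal to exactly one
   vector [w - c x] for each [w].  Letting [x + t w] tend to [x] from both sides,
   rho-symmetry makes both extreme Birkhoff-James orthogonal directions at [x]
   orthogonal back to [x], and convexity gives the directions in between: the space
   is BJ-symmetric.  A kink of the norm at [x] would then make [x] rho-orthogonal to
   several vectors [w - c x], so the norm is smooth and [rho x] is linear.
   In dimension at least 3, [|u + v|] does not change when [v] moves along the unit
   circle of a plane contained in the kernel of [rho u]: the velocity [d] is
   orthogonal to [v] and to [u], hence so is [u + v] to [d].  Going from [v] to [- v]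
   gives [|u + v| = |u - v|] for orthogonal [u], [v].  This forces
   [|s p + t r| = |t p + s r|] whenever [|p| = |r|] (Ficken's condition), and
   differentiating at [t = 0] shows that [rho] is symmetric, hence an inner
   product. *)
Require Import Defs.
From HB Require Import structures.
From mathcomp Require Import all_boot all_order all_algebra.
From mathcomp Require Import all_classical all_reals all_analysis.
From mathcomp Require Import ring lra.

Set Implicit Arguments.
Unset Strict Implicit.
Unset Printing Implicit Defensive.

Import Order.TTheory GRing.Theory Num.Theory.
Import numFieldNormedType.Exports.

Local Open Scope classical_set_scope.
Local Open Scope ring_scope.

(** * Linear combinations of three vectors, by reflection *)

Inductive vexp (R : Type) :=
  | VX | VY | VZ | V0 | VAdd of vexp R & vexp R | VOpp of vexp R
  | VScale of R & vexp R.
Arguments VX {R}.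
Arguments VY {R}.
Arguments VZ {R}.
Arguments V0 {R}.

Fixpoint veval (R : pzRingType) (V : lmodType R) (x y z : V) (e : vexp R) : V :=
  match e with
  | VX => x | VY => y | VZ => z | V0 => 0
  | VAdd e f => veval x y z e + veval x y z f
  | VOpp e => - veval x y z e
  | VScale a e => a *: veval x y z e
  end.

Fixpoint vcoef (R : pzRingType) (a b c : R) (e : vexp R) : R :=
  match e with
  | VX => a | VY => b | VZ => c | V0 => 0
  | VAdd e f => vcoef a b c e + vcoef a b c f
  | VOpp e => - vcoef a b c e
  | VScale k e => k * vcoef a b c e
  end.

Lemma vevalE (R : pzRingType) (V : lmodType R) (x y z : V) (e : vexp R) :
  veval x y z e =
  vcoef 1 0 0 e *: x + vcoef 0 1 0 e *: y + vcoef 0 0 1 e *: z.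
Proof.
elim: e => /= [||||e1 -> e2 ->|e ->|k e ->].
- by rewrite scale1r !scale0r !addr0.
- by rewrite scale1r !scale0r add0r addr0.
- by rewrite scale1r !scale0r !add0r.
- by rewrite !scale0r !addr0.
- by rewrite !scalerDl addrACA; congr (_ + _); rewrite addrACA.
- by rewrite !opprD !scaleNr.
- by rewrite !scalerDr !scalerA.
Qed.

Lemma veval_eq (R : pzRingType) (V : lmodType R) (x y z : V) (e f : vexp R) :
  vcoef 1 0 0 e = vcoef 1 0 0 f -> vcoef 0 1 0 e = vcoef 0 1 0 f ->
  vcoef 0 0 1 e = vcoef 0 0 1 f -> veval x y z e = veval x y z f.
Proof. by rewrite !vevalE => -> -> ->. Qed.

Ltac vreify x y z t :=
  lazymatch t with
  | x => open_constr:(VX)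
  | y => open_constr:(VY)
  | z => open_constr:(VZ)
  | 0 => open_constr:(V0)
  | ?u + ?v =>
      let e := vreify x y z u in let f := vreify x y z v in
      open_constr:(VAdd e f)
  | - ?u => let e := vreify x y z u in open_constr:(VOpp e)
  | ?a *: ?u => let e := vreify x y z u in open_constr:(VScale a e)
  end.

(* Reduces an identity between linear combinations of [x], [y] and [z] to the
   three identities between their coefficients. *)
Ltac lincomb x y z :=
  lazymatch goal with
  | |- ?u = ?v =>
      let e := vreify x y z u in let f := vreify x y z v in
      apply: (@veval_eq _ _ x y z e f); rewrite /=
  end.

(** * One-sided directional derivatives of the norm *)

Section directional_derivative.
Context {R : realType} {X : normedModType R}.
Implicit Types (x y z w : X) (s t : R).

Lemma normZ_ge0 t x : 0 <= t -> `|t *: x| = t * `|x|.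
Proof. by move=> t0; rewrite normrZ ger0_norm. Qed.

Definition slope x y t : R := (`|x + t *: y| - `|x|) / t.

(** This is [rho_plus] without the factor [|x|]; the left derivative is [- ndir x (- y)], so limits
    from the right suffice. *)
Definition ndir x y : R := lim (slope x y t @[t --> 0^'+]).

Lemma slope_ge x y t : 0 < t -> - `|y| <= slope x y t.
Proof.
move=> t0; rewrite /slope ler_pdivlMr //.
have : `|x| <= `|x + t *: y| + `|t *: y|.
  by rewrite -{1}(addrK (t *: y) x) ler_normB.
by rewrite normZ_ge0 ?(ltW t0) //; nra.
Qed.

Lemma slope_le x y t : 0 < t -> slope x y t <= `|y|.
Proof.
move=> t0; rewrite /slope ler_pdivrMr //.
by have := ler_normD x (t *: y); rewrite normZ_ge0 ?(ltW t0) //; nra.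
Qed.

(** Convexity: [x + s *: y] divides the segment from [x] to [x + t *: y] in the ratio given by
    [s / t]. *)
Lemma slope_nondecreasing x y s t : 0 < s -> s <= t ->
  slope x y s <= slope x y t.
Proof.
move=> s0 st; have t0 : 0 < t by lra.
rewrite /slope ler_pdivrMr // mulrAC ler_pdivlMr //.
have -> : x + s *: y = (1 - s / t) *: x + (s / t) *: (x + t *: y).
  by lincomb x y y; field; lra.
have st1 : s / t <= 1 by rewrite ler_pdivrMr ?mul1r.
have st0 : 0 <= s / t by rewrite divr_ge0 // ltW.
have /(ler_wpM2r (ltW t0)) :=
  ler_normD ((1 - s / t) *: x) ((s / t) *: (x + t *: y)).
rewrite (normZ_ge0 _ st0) normZ_ge0 ?subr_ge0 //.
rewrite -[X in _ -> _ <= _ * X](divfK (lt0r_neq0 t0)); lra.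
Qed.

Lemma slope_is_cvg x y : cvg (slope x y t @[t --> 0^'+]).
Proof.
apply: nondecreasing_at_right_is_cvgr.
- near=> u => s t; rewrite !in_itv/= => /andP[s0 _] /andP[t0 _].
  exact: slope_nondecreasing.
- near=> u; exists (- `|y|) => _ [s + <-].
  by rewrite /= in_itv/= => /andP[s0 _]; exact: slope_ge.
Unshelve. all: by end_near. Qed.

Lemma slope_cvg x y : slope x y t @[t --> 0^'+] --> ndir x y.
Proof. exact: slope_is_cvg. Qed.

Lemma cvg_addZ_at_right x w : x + t *: w @[t --> (0 : R)^'+] --> x.
Proof.
rewrite -{2}[x]addr0 -(scale0r w).
apply: cvg_at_right_filter; apply: cvgD; first exact: cvg_cst.
by apply: cvgZr_tmp; exact: cvg_id.
Qed.

Lemma cvg_double_at_right : 2 * t @[t --> (0 : R)^'+] --> (0 : R)^'+.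
Proof.
move=> P [e /= e0 He]; exists (e / 2); first by rewrite /= divr_gt0.
move=> t /=; rewrite !sub0r !normrN => te t0; apply: He;
  last by rewrite mulr_gt0.
by rewrite /= sub0r normrN normrM gtr0_norm // mulrC -ltr_pdivlMr.
Qed.

Lemma slope2_cvg x y : slope x y (2 * t) @[t --> 0^'+] --> ndir x y.
Proof. exact: cvg_comp cvg_double_at_right (@slope_cvg x y). Qed.

Lemma ndir_le_slope x y t : 0 < t -> ndir x y <= slope x y t.
Proof.
move=> t0; apply: limr_le; first exact: slope_is_cvg.
near=> s; apply: slope_nondecreasing; near: s.
  exact: nbhs_right_gt.
exact: nbhs_right_le.
Unshelve. all: by end_near. Qed.

Lemma ndir_ge_lb x y c : (forall t, 0 < t -> c <= slope x y t) -> c <= ndir x y.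
Proof.
move=> h; apply: limr_ge; first exact: slope_is_cvg.
by near=> s; apply: h; near: s; exact: nbhs_right_gt.
Unshelve. all: by end_near. Qed.

Lemma ndir_le_norm x y : ndir x y <= `|y|.
Proof. exact: le_trans (ndir_le_slope x y ltr01) (slope_le x y ltr01). Qed.

Lemma norm_ge_ndir x y t : 0 <= t -> `|x| + t * ndir x y <= `|x + t *: y|.
Proof.
rewrite le_eqVlt => /orP[/eqP<-|t0]; first by rewrite mul0r scale0r !addr0.
by have := ndir_le_slope x y t0; rewrite /slope ler_pdivlMr //; lra.
Qed.

Lemma ndirx0 x : ndir x 0 = 0.
Proof.
apply/eqP; rewrite eq_le -{1}(@normr0 _ X) ndir_le_norm /=.
by apply: ndir_ge_lb => t t0; rewrite /slope scaler0 addr0 subrr mul0r.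
Qed.

Lemma ndirZr x y t : 0 <= t -> ndir x (t *: y) = t * ndir x y.
Proof.
rewrite le_eqVlt => /orP[/eqP<-|t0]; first by rewrite scale0r mul0r ndirx0.
have le z u : 0 < u -> u * ndir x z <= ndir x (u *: z).
  move=> u0; apply: ndir_ge_lb => s s0.
  have := ndir_le_slope x z (mulr_gt0 s0 u0).
  rewrite /slope ler_pdivlMr ?mulr_gt0 // ler_pdivlMr // scalerA; lra.
apply/eqP; rewrite eq_le le // andbT.
have ti : 0 < t^-1 by rewrite invr_gt0.
have := le (t *: y) _ ti; rewrite scalerA mulVf ?gt_eqF // scale1r.
by rewrite ler_pdivrMl.
Qed.

Lemma ndirZl x y t : 0 < t -> ndir (t *: x) y = ndir x y.
Proof.
have le z u : 0 < u -> ndir z y <= ndir (u *: z) y.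
  move=> u0; apply: ndir_ge_lb => s s0.
  have := ndir_le_slope z y (divr_gt0 s0 u0).
  congr (_ <= _); rewrite /slope.
  have -> : u *: z + s *: y = u *: (z + (s / u) *: y).
    by lincomb z y y; field; rewrite gt_eqF.
  by rewrite !normZ_ge0 ?(ltW u0) //; field; rewrite !gt_eqF.
move=> t0; apply/eqP; rewrite eq_le le // andbT.
have ti : 0 < t^-1 by rewrite invr_gt0.
by have := le (t *: x) _ ti; rewrite scalerA mulVf ?gt_eqF // scale1r.
Qed.

Lemma ndirNN x y : ndir (- x) (- y) = ndir x y.
Proof.
rewrite /ndir (_ : slope (- x) (- y) = slope x y) //.
by apply/funext => t; rewrite /slope scalerN -opprD !normrN.
Qed.

(** [x + t *: (y + z)] is the midpoint of [x + (2 * t) *: y] and [x + (2 * t) *: z]. *)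
Lemma ndirD x y z : ndir x (y + z) <= ndir x y + ndir x z.
Proof.
have yz : slope x y (2 * t) + slope x z (2 * t) @[t --> 0^'+] -->
    ndir x y + ndir x z.
  exact: cvgD (@slope2_cvg x y) (@slope2_cvg x z).
apply: (ler_cvg_to (@slope_cvg x (y + z)) yz).
near=> t.
have t0 : 0 < t by near: t; exact: nbhs_right_gt.
have -> : slope x y (2 * t) + slope x z (2 * t) =
    (2^-1 * (`|x + (2 * t) *: y| + `|x + (2 * t) *: z|) - `|x|) / t.
  by rewrite /slope; field; rewrite gt_eqF.
rewrite /slope ler_pM2r ?invr_gt0 // lerD2r.
have -> : x + t *: (y + z) =
    2^-1 *: ((x + (2 * t) *: y) + (x + (2 * t) *: z)).
  by lincomb x y z; field.
by rewrite normZ_ge0 ?invr_ge0 // ler_pM2l ?invr_gt0 // ler_normD.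
Unshelve. all: by end_near. Qed.

End directional_derivative.

(** * The norm derivative and Birkhoff-James orthogonality *)

Section norm_derivative.
Context {R : realType} {X : normedModType R}.
Implicit Types (x y z w : X) (s t a : R).

Lemma ndirN_le x y : - ndir x (- y) <= ndir x y.
Proof. by have := ndirD x y (- y); rewrite subrr ndirx0; lra. Qed.

Lemma ndir_self x s : ndir x (s *: x) = s * `|x|.
Proof.
have ub u : ndir x (u *: x) <= u * `|x|.
  (* The step [t = (1 + |u|)^-1] keeps [1 + t * u] nonnegative, so this factor comes out of the
     norm. *)
  have u1 : 0 < 1 + `|u| by rewrite ltr_wpDr.
  have t0 : 0 < (1 + `|u|)^-1 by rewrite invr_gt0.
  apply: le_trans (ndir_le_slope x (u *: x) t0) _.
  rewrite /slope ler_pdivrMr //.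
  have -> : x + (1 + `|u|)^-1 *: (u *: x) = (1 + (1 + `|u|)^-1 * u) *: x.
    by lincomb x x x; ring.
  rewrite normZ_ge0; first by lra.
  rewrite -(@pmulr_rge0 _ (1 + `|u|)) // mulrDr mulr1 mulrA divff ?gt_eqF //.
  by have := ler_norm (- u); rewrite normrN; lra.
have := ndirN_le x (s *: x); have := ub s; have := ub (- s).
by rewrite scaleNr; lra.
Qed.

Lemma ndirDself x y s : ndir x (y + s *: x) = ndir x y + s * `|x|.
Proof.
have := ndirD x y (s *: x); have := ndirD x (y + s *: x) (- s *: x).
by rewrite scaleNr addrK -scaleNr !ndir_self; lra.
Qed.

Lemma rhoE x y : rho x y = `|x| * (2^-1 * (ndir x y - ndir x (- y))).
Proof.
rewrite /rho /rho_plus /rho_minus -/(slope x y) -/(ndir x y).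
suff -> : lim (slope x y t @[t --> (0 : R)^'-]) = - ndir x (- y).
  by rewrite -mulrDr mulrCA.
apply: cvg_lim => //; rewrite -{1}oppr0; apply/cvg_at_leftNP; rewrite opprK.
have -> : slope x y \o -%R = \- slope x (- y).
  by apply/funext => t; rewrite /slope /= scaleNr scalerN invrN mulrN.
exact: cvgN (@slope_cvg _ _ x (- y)).
Qed.

Lemma rhoxx x : rho x x = `|x| ^+ 2.
Proof.
have := ndir_self x 1; have := ndir_self x (- 1); rewrite rhoE scale1r scaleN1r.
by move=> -> ->; field.
Qed.

Lemma rhoNr x y : rho x (- y) = - rho x y.
Proof. by rewrite !rhoE opprK; lra. Qed.

Lemma rhoNl x y : rho (- x) y = - rho x y.
Proof.
by rewrite -[y]opprK rhoNr !rhoE !opprK normrN -{2}[y]opprK !ndirNN; lra.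
Qed.

Lemma rhoZr x y a : rho x (a *: y) = a * rho x y.
Proof.
have ge0 u : 0 <= u -> rho x (u *: y) = u * rho x y.
  by move=> u0; rewrite !rhoE -scalerN !ndirZr //; ring.
have [/ge0//|a0] := leP 0 a.
by rewrite -[a]opprK scaleNr rhoNr ge0 ?mulNr //; lra.
Qed.

Lemma rho0l y : rho (0 : X) y = 0.
Proof. by rewrite rhoE normr0 mul0r. Qed.

Lemma rho0r x : rho x 0 = 0.
Proof. by rewrite -(scale0r 0) rhoZr mul0r. Qed.

Lemma rhoZl x y a : rho (a *: x) y = a * rho x y.
Proof.
have gt0 u : 0 < u -> rho (u *: x) y = u * rho x y.
  by move=> u0; rewrite !rhoE !ndirZl // normZ_ge0 ?ltW // -mulrA.
have [/gt0//|a0|<-] := ltgtP 0 a; last by rewrite scale0r mul0r rho0l.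
by rewrite -[a]opprK scaleNr rhoNl gt0 ?mulNr //; lra.
Qed.

Lemma rhoDself x y s : rho x (y + s *: x) = rho x y + s * `|x| ^+ 2.
Proof. by rewrite !rhoE opprD -scaleNr !ndirDself; field. Qed.

Lemma rho_le x y : rho x y <= `|x| * `|y|.
Proof.
rewrite rhoE ler_wpM2l //.
have := ndirN_le x y; have := ndir_le_norm x y; lra.
Qed.

Lemma rho_norm_le x y : `|rho x y| <= `|x| * `|y|.
Proof.
by rewrite ler_norml rho_le andbT lerNl -rhoNr -(normrN y) rho_le.
Qed.

(** A convex function has a minimum at a point exactly when neither one-sided derivative pointing
    away from it is negative. *)
Lemma BJ_ndirP x y :
  BJ_orthogonal x y <-> 0 <= ndir x y /\ 0 <= ndir x (- y).
Proof.
split=> [h|[h1 h2] l].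
  split; apply: ndir_ge_lb => t t0; rewrite /slope divr_ge0 ?(ltW t0) // subr_ge0;
    by rewrite ?scalerN -?scaleNr; exact: h.
have [l0|l0] := leP 0 l.
  by have := norm_ge_ndir x y l0; nra.
have l0' : 0 <= - l by lra.
by have := norm_ge_ndir x (- y) l0'; rewrite scalerN scaleNr opprK; nra.
Qed.

(** For nonzero [x], [ndir x y] and [ndir x (- y)] are then equal, and their sum is never
    negative. *)
Lemma rho_BJ x y : rho_orthogonal x y -> BJ_orthogonal x y.
Proof.
have [-> _ l|x0] := eqVneq x 0; first by rewrite normr0.
rewrite /rho_orthogonal rhoE => /eqP; rewrite mulf_eq0 normr_eq0 (negPf x0) /=.
move=> /eqP h; apply/BJ_ndirP; have := ndirN_le x y; lra.
Qed.

(* The mean of the one-sided derivatives of a convex function is squeezed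
   between its slopes on the two sides, so it tends to the right derivative. *)
Lemma mean_ndir_cvg x w :
  2^-1 * (ndir (x + t *: w) w - ndir (x + t *: w) (- w)) @[t --> (0 : R)^'+]
    --> ndir x w.
Proof.
(* The upper bound is the slope of the norm between [x + t *: w] and [x + (2 * t) *: w]. *)
have ub : 2 * slope x w (2 * t) - slope x w t @[t --> (0 : R)^'+] --> ndir x w.
  rewrite (_ : ndir x w = 2 * ndir x w - ndir x w); last by ring.
  apply: cvgB (@slope_cvg _ _ x w).
  by apply: cvgMl_tmp; exact: (@slope2_cvg _ _ x w).
apply: squeeze_cvgr (@slope_cvg _ _ x w) ub; near=> t.
have t0 : 0 < t by near: t; exact: nbhs_right_gt.
have := ndir_le_slope (x + t *: w) w t0.
have := ndir_le_slope (x + t *: w) (- w) t0.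
have := ndirN_le (x + t *: w) w.
rewrite /slope scalerN addrK.
have -> : x + t *: w + t *: w = x + (2 * t) *: w by lincomb x w w; ring.
have -> : (`|x| - `|x + t *: w|) / t = - ((`|x + t *: w| - `|x|) / t).
  by rewrite -mulNr opprB.
have -> : 2 * ((`|x + (2 * t) *: w| - `|x|) / (2 * t)) -
    (`|x + t *: w| - `|x|) / t = (`|x + (2 * t) *: w| - `|x + t *: w|) / t.
  by field; rewrite gt_eqF.
set a := ndir _ w; set b := ndir _ (- w); set c := _ / t; set d := _ / t.
by move=> *; apply/andP; split; lra.
Unshelve. all: by end_near. Qed.

End norm_derivative.

(** * Symmetry of Birkhoff-James orthogonality, and smoothness *)

Section rho_symmetric_BJ.
Context {R : realType} {X : normedModType R}.
Hypothesis rhoS : rho_symmetric X.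
Implicit Types (x y z w : X) (s t a : R).

(** Each [xt t] is rho-orthogonal to [w - d t *: xt t]; rho-symmetry reverses this, and the
    resulting norm inequality survives the limit, in which [d t] tends to the extreme coefficient
    [c]. *)
Lemma ndir_tangent_BJ x w : x != 0 ->
  BJ_orthogonal (w - (ndir x w / `|x|) *: x) x.
Proof.
move=> x0 l; set c := ndir x w / `|x|.
pose xt t := x + t *: w.
pose k t := 2^-1 * (ndir (xt t) w - ndir (xt t) (- w)).
pose d t := k t / `|xt t|.
have xt_cvg : xt t @[t --> (0 : R)^'+] --> x :=
    @cvg_addZ_at_right _ _ x w.
have d_cvg : d t @[t --> (0 : R)^'+] --> c.
  apply: cvgM (@mean_ndir_cvg _ _ x w) _.
  by apply: cvgV; [rewrite normr_eq0|exact: cvg_norm].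
have lhs : `|w - d t *: xt t| @[t --> (0 : R)^'+] --> `|w - c *: x|.
  by apply: cvg_norm; apply: cvgB; [exact: cvg_cst|exact: cvgZ].
have rhs : `|w + (l - c) *: xt t| @[t --> (0 : R)^'+] --> `|w + (l - c) *: x|.
  by apply: cvg_norm; apply: cvgD; [exact: cvg_cst|exact: cvgZl_tmp].
rewrite (_ : w - c *: x + l *: x = w + (l - c) *: x); last first.
  by lincomb w x x; ring.
apply: (ler_cvg_to lhs rhs); near=> t.
have orth : rho_orthogonal (xt t) (w - d t *: xt t).
  rewrite /rho_orthogonal -scaleNr rhoDself rhoE -/(k t) /d.
  have [->|xt0] := eqVneq `|xt t| 0; first by ring.
  by field.
have /(_ (l - c + d t)) := rho_BJ (rhoS orth).
by congr (_ <= `|_|); lincomb w (xt t) x; ring.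
Unshelve. all: by end_near. Qed.

Lemma rho_symmetric_BJ : BJ_symmetric X.
Proof.
move=> x y xy l; have [->|x0] := eqVneq x 0; first by rewrite scaler0 addr0.
have /BJ_ndirP[] := xy.
have := ndir_tangent_BJ y x0; have := ndir_tangent_BJ (- y) x0.
have nx : 0 < `|x| by rewrite normr_gt0.
(* The extreme directions [y - r *: x] and [y + s *: x] enclose [y] and both minimise the norm on
   the line through [y] along [x]; by convexity so does [y]. *)
set s := ndir x (- y) / `|x|; set r := ndir x y / `|x| => hs hr d1 d2.
have r0 : 0 <= r by rewrite divr_ge0.
have s0 : 0 <= s by rewrite divr_ge0.
have {}hr : `|y - r *: x| <= `|y + l *: x|.
  by have := hr (l + r); congr (_ <= `|_|); lincomb x y y; ring.
have {}hs : `|y + s *: x| <= `|y + l *: x|.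
  have := hs (s - l); rewrite -(normrN (y + s *: x)) -(normrN (y + l *: x)).
  have -> : - y - s *: x = - (y + s *: x) by lincomb x y y; ring.
  have -> // : - (y + s *: x) + (s - l) *: x = - (y + l *: x).
  by lincomb x y y; ring.
have [e|e] := eqVneq (r + s) 0.
  have e2 : r = 0 by lra.
  by move: hr; rewrite e2 scale0r subr0.
have e0 : 0 < r + s by lra.
have -> : y = (r + s)^-1 *: (s *: (y - r *: x) + r *: (y + s *: x)).
  by lincomb x y y; field.
rewrite normZ_ge0 ?invr_ge0 ?(ltW e0) // ler_pdivrMl //.
apply: le_trans (ler_normD _ _) _; rewrite !normZ_ge0 //.
have -> : (r + s)^-1 *: (s *: (y - r *: x) + r *: (y + s *: x)) = y.
  by lincomb x y y; field.
by nra.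
Qed.

(* If [x] had a kink in the direction [w], all [y = w - s x] with [s] in an open
   interval would be orthogonal to [x]; the norm is then constant along [x] near
   such a [y], so [rho y x = 0] and hence [rho x y = 0] for all these [s]. *)
Lemma rho_symmetric_smooth x w : x != 0 -> ndir x (- w) = - ndir x w.
Proof.
move=> x0; apply/eqP/negPn/negP => kink.
have nx : 0 < `|x| by rewrite normr_gt0.
have lt : - ndir x (- w) < ndir x w.
  rewrite lt_neqAle ndirN_le andbT; apply: contraNneq kink => <-.
  by rewrite opprK.
pose y s := w - (s / `|x|) *: x.
have yx s : - ndir x (- w) <= s <= ndir x w -> BJ_orthogonal (y s) x.
  move=> /andP[s1 s2]; apply: rho_symmetric_BJ; apply/BJ_ndirP.
  have -> : - y s = - w + (s / `|x|) *: x by rewrite /y; lincomb x w w; ring.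
  by rewrite /y -scaleNr !ndirDself mulNr divfK ?gt_eqF //; split; lra.
have yconst s r : - ndir x (- w) <= s <= ndir x w ->
    - ndir x (- w) <= r <= ndir x w -> `|y s| = `|y r|.
  have le a b : - ndir x (- w) <= a <= ndir x w -> `|y a| <= `|y b|.
    move=> /yx /(_ ((a - b) / `|x|)); congr (_ <= `|_|).
    by rewrite /y; lincomb x w w; field; rewrite gt_eqF.
  by move=> hs hr; apply/eqP; rewrite eq_le !le.
have ndir0 s a : - ndir x (- w) < s < ndir x w -> a != 0 ->
    ndir (y s) (a *: x) = 0.
  move=> /andP[s1 s2] a0; apply/eqP; rewrite eq_le; apply/andP; split;
    last first.
    apply: ndir_ge_lb => t t0; rewrite /slope divr_ge0 ?(ltW t0) // subr_ge0.
    by rewrite scalerA; apply: yx; rewrite !ltW.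
  have a1 : 0 < `|a| * `|x| by rewrite mulr_gt0 ?normr_gt0.
  (* [m] is the distance from [s] to the nearer end of the interval; the step [t] moves the
     parameter by exactly [m], so it stays in the closed interval, where the norm of [y] is
     constant. *)
  pose m := Num.min (s + ndir x (- w)) (ndir x w - s).
  have m0 : 0 < m by rewrite lt_min; apply/andP; split; lra.
  have [m1 m2] : m <= s + ndir x (- w) /\ m <= ndir x w - s.
    by rewrite !ge_min !lexx orbT.
  have [t t0 tE] : exists2 t, 0 < t & t * (`|a| * `|x|) = m.
    by exists (m / (`|a| * `|x|)); rewrite ?divr_gt0 ?divfK ?gt_eqF.
  apply: le_trans (ndir_le_slope _ _ t0) _.
  have -> : slope (y s) (a *: x) t = (`|y (s - t * a * `|x|)| - `|y s|) / t.
    congr ((`|_| - _) / _); rewrite /y; lincomb x w w; field; rewrite gt_eqF //.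
  rewrite (yconst s (s - t * a * `|x|)) ?subrr ?mul0r //; first by rewrite !ltW.
  have : `|t * a * `|x| | = m.
    by rewrite !normrM normr_id (gtr0_norm t0) -mulrA.
  have := ler_norm (t * a * `|x|); have := ler_norm (- (t * a * `|x|)).
  by rewrite normrN => h1 h2 h3; apply/andP; split; lra.
have orth s : - ndir x (- w) < s < ndir x w -> rho x w = s * `|x|.
  move=> hs; have : rho_orthogonal x (y s).
    have := ndir0 s 1 hs (oner_neq0 _); have := ndir0 s (- 1) hs.
    rewrite oppr_eq0 oner_eq0 scale1r scaleN1r => /(_ isT) h1 h2.
    by apply: rhoS; rewrite /rho_orthogonal rhoE h1 h2 subrr !mulr0.
  rewrite /rho_orthogonal /y -scaleNr rhoDself => /eqP.
  rewrite addr_eq0 => /eqP->.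
  by field; rewrite gt_eqF.
set a := - ndir x (- w) in lt orth; set b := ndir x w in lt orth.
(* Two distinct interior points would give [rho x w] two distinct values. *)
have := orth ((2 * a + b) / 3); have := orth ((a + 2 * b) / 3).
move=> /(_ _) -> => [/(_ _)/(mulIf (lt0r_neq0 nx))|]; last by lra.
by move=> /(_ _); lra.
Qed.

End rho_symmetric_BJ.

(** Cutting [[a, b]] into [n + 1] equal parts, the increments of [k] telescope, so
    [(n + 1) |phi b - phi a|] has a bound independent of [n]. This stands in for a derivative of
    [phi] equal to zero. *)
Lemma telescope_constant (R : realType) (phi k : R -> R) (c a b : R) :
  a <= b ->
  (forall s t, s <= t -> `|phi t - phi s| <= c * ((t - s) * (k t - k s))) ->
  phi a = phi b.
Proof.
move=> ab H; apply/eqP/negPn/negP => neq.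
have D0 : 0 < `|phi b - phi a| by rewrite normr_gt0 subr_eq0 eq_sym.
have sub n : n.+1%:R * `|phi b - phi a| <= c * ((b - a) * (k b - k a)).
  pose h := (b - a) / n.+1%:R; have h0 : 0 <= h by rewrite divr_ge0 ?subr_ge0.
  pose s i := a + i%:R * h.
  have part i : `|phi (s i) - phi a| <= c * (h * (k (s i) - k a)).
    elim: i => [|i IH]; first by rewrite /s mul0r addr0 !subrr normr0 !mulr0.
    have sS : s i.+1 - s i = h by rewrite /s -natr1; ring.
    have /H : s i <= s i.+1 by rewrite -subr_ge0 sS.
    rewrite sS => le.
    have := ler_normD (phi (s i.+1) - phi (s i)) (phi (s i) - phi a).
    by rewrite subrKA; lra.
  have n0 : 0 < n.+1%:R :> R by [].
  have := part n.+1.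
  have -> : s n.+1 = b by rewrite /s mulrC divfK ?gt_eqF // addrC subrK.
  rewrite -(ler_pM2l n0); congr (_ <= _); rewrite /h; field.
  by rewrite gt_eqF.
pose q := c * ((b - a) * (k b - k a)) / `|phi b - phi a|.
have := sub (Num.bound `|q|); rewrite leNgt -ltr_pdivrMr // -/q => /negP; apply.
apply: le_lt_trans (ler_norm q) _.
by apply: lt_le_trans (archi_boundP (normr_ge0 q)) _; rewrite ler_nat.
Qed.

(** * Linearity of [rho x], and the norm of [u + v] as [v] turns *)

Section smooth.
Context {R : realType} {X : normedModType R}.
Hypothesis rhoS : rho_symmetric X.
Implicit Types (x y z w u v e p q : X) (s t a h : R).

Lemma rho_ndir x y : rho x y = `|x| * ndir x y.
Proof.
have [->|x0] := eqVneq x 0; first by rewrite rho0l normr0 mul0r.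
by rewrite rhoE (rho_symmetric_smooth rhoS) //; field.
Qed.

Lemma rhoDr x y z : rho x (y + z) = rho x y + rho x z.
Proof.
have [->|x0] := eqVneq x 0; first by rewrite !rho0l addr0.
have := ndirD x y z; have := ndirD x (- y) (- z).
rewrite -opprD !(rho_symmetric_smooth rhoS) // !rho_ndir -mulrDr => h1 h2.
by congr (_ * _); lra.
Qed.

Lemma BJ_rho x y : BJ_orthogonal x y -> rho x y = 0.
Proof.
have [->|x0] := eqVneq x 0; first by rewrite rho0l.
move=> /BJ_ndirP; rewrite (rho_symmetric_smooth rhoS) // rho_ndir => -[h1 h2].
have -> : ndir x y = 0 by lra.
by rewrite mulr0.
Qed.

(** A form of strict convexity: by symmetry [rho y] vanishes at [x] and at [x + a *: y], but it
    grows by [a * |y|^2] between them. *)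
Lemma rho_orthogonal_unique x y a : y != 0 ->
  rho x y = 0 -> rho (x + a *: y) y = 0 -> a = 0.
Proof.
move=> y0 /rhoS xy /rhoS; rewrite /rho_orthogonal rhoDself xy add0r => /eqP.
by rewrite mulf_eq0 expf_eq0 normr_eq0 (negPf y0) orbF => /eqP.
Qed.

(** The vector [d = q - a *: p] is orthogonal to [u] and [p], hence [u + a *: p] is orthogonal to
    [d], and adding [d] to it, which gives [u + q], cannot shorten it. The loss [1 - rho p q] comes
    from replacing [p] by [a *: p]. *)
Lemma norm_add_orthogonal_ge u p q : rho u p = 0 -> rho u q = 0 ->
  `|p| = 1 -> `|q| = 1 -> `|u + p| - (1 - rho p q) <= `|u + q|.
Proof.
move=> up uq p1 q1; set a := rho p q.
have a1 : a <= 1 by have := rho_le p q; rewrite p1 q1 mulr1.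
pose d := q - a *: p.
have pd : rho d p = 0.
  by apply: rhoS; rewrite /rho_orthogonal /d -scaleNr rhoDself p1 -/a; ring.
have ud : rho d u = 0.
  by apply: rhoS; rewrite /rho_orthogonal /d -scaleNr rhoDr rhoZr uq up; ring.
have /rho_BJ/(_ 1) : rho (u + a *: p) d = 0.
  by apply: rhoS; rewrite /rho_orthogonal rhoDr rhoZr ud pd; ring.
have -> : u + a *: p + 1 *: d = u + q by rewrite /d; lincomb u p q; ring.
apply: le_trans.
have : `|u + p| <= `|u + a *: p| + `|(1 - a) *: p|.
  apply: le_trans (ler_normD _ _); rewrite le_eqVlt; apply/orP; left.
  by apply/eqP; congr `|_|; lincomb u p p; ring.
by rewrite normZ_ge0 ?subr_ge0 // p1; lra.
Qed.

Definition normalize v : X := `|v|^-1 *: v.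

Lemma norm_normalize v : v != 0 -> `|normalize v| = 1.
Proof. by move=> v0; rewrite normZ_ge0 ?invr_ge0 // mulVf ?normr_eq0. Qed.

Lemma norm_ge_rho v e h : v != 0 ->
  `|v| + h * (rho v e / `|v|) <= `|v + h *: e|.
Proof.
move=> v0; have nv : 0 < `|v| by rewrite normr_gt0.
have := rho_le v (v + h *: e).
rewrite rhoDr rhoZr rhoxx -(ler_pdivrMl _ _ nv); congr (_ <= _).
by field; rewrite gt_eqF.
Qed.

(** Times [|v + h *: e|], the left side is the gap between the norm at [v + h *: e] and its tangent
    at [v]; the tangent at [v + h *: e] bounds this gap. *)
Lemma rho_normalize_ge v e h : v != 0 -> v + h *: e != 0 ->
  1 - rho (normalize v) (normalize (v + h *: e)) <=
  h * (rho (v + h *: e) e / `|v + h *: e| - rho v e / `|v|) / `|v + h *: e|.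
Proof.
move=> v0; set w := v + h *: e => w0.
have nv : 0 < `|v| by rewrite normr_gt0.
have nw : 0 < `|w| by rewrite normr_gt0.
have := norm_ge_rho e (- h) w0.
have -> : w + (- h) *: e = v by rewrite /w; lincomb v e e; ring.
rewrite /normalize rhoZl rhoZr {2}/w rhoDr rhoZr rhoxx => le.
rewrite ler_pdivlMr //.
have -> : (1 - `|v|^-1 * (`|w|^-1 * (`|v| ^+ 2 + h * rho v e))) * `|w| =
    `|w| - `|v| - h * (rho v e / `|v|) by field; rewrite !gt_eqF.
lra.
Qed.

(** The two bounds above, used in both directions, give the hypothesis of [telescope_constant] with
    [c = m^-1] and [k] the derivative of [|v + t *: e|]. *)
Lemma normalize_path_constant u v e m : rho u v = 0 -> rho u e = 0 -> 0 < m ->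
  (forall t, m <= `|v + t *: e|) ->
  forall s t, `|u + normalize (v + s *: e)| = `|u + normalize (v + t *: e)|.
Proof.
move=> uv ue m0 hm.
pose phi t := `|u + normalize (v + t *: e)|.
pose k t := rho (v + t *: e) e / `|v + t *: e|.
have nz t : v + t *: e != 0 by rewrite -normr_gt0 (lt_le_trans m0).
have orth t : rho u (normalize (v + t *: e)) = 0.
  by rewrite rhoZr rhoDr rhoZr uv ue; ring.
have step s t : phi s - m^-1 * ((t - s) * (k t - k s)) <= phi t.
  have := norm_add_orthogonal_ge (orth s) (orth t)
    (norm_normalize (nz s)) (norm_normalize (nz t)).
  apply: le_trans; rewrite lerB //.
  have e1 : v + t *: e = v + s *: e + (t - s) *: e by lincomb v e e; ring.
  have := @rho_normalize_ge (v + s *: e) e (t - s).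
  rewrite -e1 -/(k t) -/(k s) => /(_ (nz s) (nz t)) /le_trans; apply.
  (* Monotonicity of [k], which allows [|v + t *: e|^-1] to be replaced by the larger [m^-1]. *)
  have kk : 0 <= (t - s) * (k t - k s).
    have := norm_ge_rho e (t - s) (nz s); rewrite -e1 -/(k s).
    have := norm_ge_rho e (s - t) (nz t); rewrite -/(k t).
    have -> : v + t *: e + (s - t) *: e = v + s *: e by lincomb v e e; ring.
    lra.
  by rewrite [leRHS]mulrC ler_wpM2l // lef_pV2 ?posrE ?normr_gt0.
suff main s t : s <= t -> phi s = phi t.
  move=> s t; have [st|/ltW ts] := leP s t; first exact: main.
  by apply/esym; exact: main.
move=> st; apply: (telescope_constant st) => a b _.
have dist (x y d : R) : x - d <= y -> y - d <= x -> `|y - x| <= d.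
  by move=> xy yx; rewrite ler_norml; apply/andP; split; lra.
apply: dist (step a b) _; have := step b a.
by have -> : (a - b) * (k a - k b) = (b - a) * (k b - k a) by ring.
Qed.

End smooth.

(** * Dimension at least 3: from orthogonality to an inner product *)

Section isosceles.
Context {R : realType} {X : normedModType R}.
Hypothesis rhoS : rho_symmetric X.
Hypothesis dim3 : dim_ge X 3.
Implicit Types (x y z w u v e p q : X) (s t a h : R).

(** Two linear functionals on three independent vectors form a 3 by 2 matrix, whose left kernel is
    nonzero. *)
Lemma common_orthogonal u v : exists2 w, w != 0 & rho u w = 0 /\ rho v w = 0.
Proof.
have [e e_free] := dim3.
pose A : 'M[R]_(3, 2) := \matrix_(i, j) rho (if j == 0 then u else v) (e i).
have : kermx A != 0.
  rewrite kermx_eq0 /row_free; apply/negP => /eqP rA.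
  by have := rank_leq_col A; rewrite rA.
move=> /rowV0Pn[c /sub_kermxP cA c0].
have rho_sum x : rho x (\sum_i c 0 i *: e i) = \sum_i c 0 i * rho x (e i).
  apply: (big_ind2 (fun z a => rho x z = a)) => [|y a z b <- <-|i _].
  - exact: rho0r.
  - exact: rhoDr.
  - exact: rhoZr.
exists (\sum_i c 0 i *: e i).
  apply: contra_neq c0 => /e_free c0.
  by apply/rowP => i; rewrite mxE c0.
move/rowP: cA => cA; split.
  have := cA 0; rewrite !mxE rho_sum => e0; rewrite -[RHS]e0.
  by apply: eq_bigr => i _; rewrite mxE.
have := cA 1; rewrite !mxE rho_sum => e0; rewrite -[RHS]e0.
by apply: eq_bigr => i _; rewrite mxE.
Qed.

Lemma norm_add_orthonormal u v w : rho u v = 0 -> rho u w = 0 -> rho v w = 0 ->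
  `|v| = 1 -> `|w| = 1 -> `|u + v| = `|u + w|.
Proof.
move=> uv uw vw v1 w1.
have ue : rho u (w - v) = 0 by rewrite rhoDr // rhoNr uv uw; ring.
(* The values [1 - t] and [t] of [rho v] and [rho w] are both at most the norm, and one of them is
   at least one half. *)
have half t : 2^-1 <= `|v + t *: (w - v)|.
  have -> : v + t *: (w - v) = (1 - t) *: v + t *: w by lincomb v w w; ring.
  set z := _ + _; have wv : rho w v = 0 := rhoS vw.
  have vz : rho v z = 1 - t by rewrite rhoDr // !rhoZr vw rhoxx v1; ring.
  have wz : rho w z = t by rewrite rhoDr // !rhoZr wv rhoxx w1; ring.
  have := rho_le v z; have := rho_le w z; rewrite vz wz v1 w1; lra.
have half0 : (0 : R) < 2^-1 by rewrite invr_gt0.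
have := normalize_path_constant rhoS uv ue half0 half 0 1.
rewrite scale0r addr0 scale1r [v + _]addrC subrK.
by rewrite /normalize v1 w1 invr1 !scale1r.
Qed.

(** The segment from [v] to [- v] meets 0, so the path makes two quarter turns through a unit vector
    [w'] orthogonal to [u] and [v]. *)
Lemma orthogonal_isosceles u v : rho u v = 0 -> `|u + v| = `|u - v|.
Proof.
have [-> _|v0 uv] := eqVneq v 0; first by rewrite oppr0.
have nv : 0 < `|v| by rewrite normr_gt0.
have [w w0 [uw vw]] := common_orthogonal u v.
pose u' := `|v|^-1 *: u; pose v' := normalize v; pose w' := normalize w.
have [uv' uw' vw'] : [/\ rho u' v' = 0, rho u' w' = 0 & rho v' w' = 0].
  by rewrite !rhoZl !rhoZr uv uw vw !mulr0.
have : `|u' + v'| = `|u' - v'|.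
  rewrite (norm_add_orthonormal uv' uw' vw') ?norm_normalize //; apply/esym.
  by apply: norm_add_orthonormal;
    rewrite ?rhoNr ?rhoNl ?uv' ?vw' ?oppr0 ?normrN ?norm_normalize.
rewrite /u' /v' /normalize -scalerDr -scalerBr !normZ_ge0 ?invr_ge0 //.
by apply: mulfI; rewrite invr_eq0 gt_eqF.
Qed.

(* The reflection fixing [m] and negating [q = p - r], where [q] is orthogonal to
   [m], preserves the norm and the line through [p] and [r]; by strict convexity
   this line meets the sphere in [p] and [r] only, so the reflection swaps them. *)
Lemma ficken p r s t : `|p| = `|r| -> `|s *: p + t *: r| = `|t *: p + s *: r|.
Proof.
move=> pr; have [<-|p_neq_r] := eqVneq p r; first by rewrite addrC.
pose q := p - r; have q0 : q != 0 by rewrite subr_eq0.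
have nq : `|q| != 0 by rewrite normr_eq0.
pose b := rho q p / `|q| ^+ 2; pose m := p - b *: q.
have qm : rho q m = 0.
  by rewrite /m -scaleNr rhoDself /b; field.
have mq : rho m q = 0 := rhoS qm.
have even a : `|m + a *: q| = `|m + (- a) *: q|.
  by rewrite scaleNr orthogonal_isosceles // rhoZr mq mulr0.
have pE : p = m + b *: q by rewrite /m subrK.
have rE : r = m + (b - 1) *: q by rewrite /m /q; lincomb p r r; ring.
(* Equal norms at [a < c] force, by convexity, the minimal norm [|m|] at [c]; then [m + c *: q] is
   orthogonal to [q] as [m] is, against uniqueness. *)
have flat a c : 0 <= a -> a < c -> `|m + a *: q| = `|m + c *: q| -> False.
  move=> a0 ac ac_eq; have c0 : 0 < c by lra.
  have min : `|m + c *: q| <= `|m|.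
    have := ler_normD ((c - a) *: m) (a *: (m + c *: q)).
    have -> : (c - a) *: m + a *: (m + c *: q) = c *: (m + a *: q).
      by lincomb m q q; ring.
    by rewrite !normZ_ge0 ?subr_ge0 ?(ltW ac) ?(ltW c0) // ac_eq; nra.
  suff : c = 0 by lra.
  apply: (rho_orthogonal_unique rhoS q0 mq); apply: BJ_rho => // l.
  have -> : m + c *: q + l *: q = m + (c + l) *: q by lincomb m q q; ring.
  apply: le_trans min _.
  exact: (rho_BJ mq).
have b2 : b = 2^-1.
  have abs a : `|m + `|a| *: q| = `|m + a *: q|.
    by have [_|_] := ler0P a; [rewrite -even|].
  have ea : `|m + `|b| *: q| = `|p| by rewrite abs -pE.
  have ec : `|m + `|b - 1| *: q| = `|p| by rewrite pr abs -rE.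
  have [lt|lt|eq] := ltgtP `|b| `|b - 1|.
  - by case: (flat _ _ (normr_ge0 b) lt); rewrite ea ec.
  - by case: (flat _ _ (normr_ge0 (b - 1)) lt); rewrite ea ec.
  - by move: eq; case: (ler0P b) => ?; case: (ler0P (b - 1)) => ?; lra.
(* With [b = 2^-1], exchanging [s] and [t] only changes the sign of the [q] component. *)
have := @orthogonal_isosceles ((s + t) *: m) ((2^-1 * (s - t)) *: q).
rewrite rhoZl rhoZr mq !mulr0 => /(_ erefl).
have -> : (s + t) *: m + (2^-1 * (s - t)) *: q = s *: p + t *: r.
  by rewrite pE rE b2; lincomb m q q; field.
have -> // : (s + t) *: m - (2^-1 * (s - t)) *: q = t *: p + s *: r.
by rewrite pE rE b2; lincomb m q q; field.
Qed.

(** For unit vectors Ficken's condition makes the two slope functions equal; homogeneity does the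
    rest. *)
Lemma rhoC x y : rho x y = rho y x.
Proof.
have [->|x0] := eqVneq x 0; first by rewrite rho0l rho0r.
have [->|y0] := eqVneq y 0; first by rewrite rho0l rho0r.
have unitC p q : `|p| = 1 -> `|q| = 1 -> rho p q = rho q p.
  move=> p1 q1; rewrite !rho_ndir // p1 q1 /ndir.
  rewrite (_ : slope p q = slope q p) //; apply/funext => t.
  have := ficken 1 t (etrans p1 (esym q1)); rewrite !scale1r => e.
  by rewrite /slope p1 q1 e [t *: p + q]addrC.
have := unitC _ _ (norm_normalize x0) (norm_normalize y0).
rewrite !rhoZl !rhoZr mulrCA => /mulfI; rewrite invr_eq0 normr_eq0 => /(_ y0).
by move=> /mulfI; rewrite invr_eq0 normr_eq0 => /(_ x0).
Qed.

Lemma rho_inner_product : is_inner_product_space X.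
Proof.
have lin x : linear (rho x : X -> R^o).
  by move=> a y z; rewrite rhoDr // rhoZr.
have linl y : linear ((@rho R X)^~ y : X -> R^o).
  by move=> a x z; rewrite rhoC rhoDr // rhoZr !(rhoC y).
have bil : bilinear_for *%R (idfun \; *%R) (@rho R X).
  by split.
pose B := bilinear_isBilinear.Build R X X R *%R (idfun \; *%R) (@rho R X) bil.
have herm x y : rho x y = (-1) ^+ false * idfun (rho y x).
  by rewrite mul1r rhoC.
have pos x : x != 0 -> 0 < rho x x.
  by move=> x0; rewrite rhoxx exprn_gt0 // normr_gt0.
pose H := isHermitianSesquilinear.Build R X false idfun (@rho R X) herm.
pose D := isDotProduct.Build R X (@rho R X) pos.
pose form : {dot X for idfun} := HB.pack (@rho R X) B H D.
by exists form => x; rewrite /= rhoxx sqrtr_sqr normr_id.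
Qed.

End isosceles.

(** * Inner product spaces are rho-symmetric *)

Section inner_product.
Context {R : realType} {X : normedModType R}.
Variable form : {dot X for idfun}.
Hypothesis norm_form : forall x, `|x| = Num.sqrt (form x x).
Implicit Types (x y : X).

Lemma form_normsq x : form x x = `|x| ^+ 2.
Proof.
rewrite norm_form sqr_sqrtr //; have [->|x0] := eqVneq x 0.
  by rewrite linear0.
by rewrite ltW // neq0_dnorm_gt0.
Qed.

Lemma formC x y : form x y = form y x.
Proof. by rewrite hermitian_subproof /= mul1r. Qed.

Lemma form_norm_add x y t :
  `|x + t *: y| ^+ 2 = `|x| ^+ 2 + 2 * t * form x y + t ^+ 2 * `|y| ^+ 2.
Proof.
rewrite -!form_normsq !linearD /= !linearZ /= ![form (_ + _) _]formC.
rewrite !linearD /= !linearZ /=.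
by rewrite (formC y x); ring.
Qed.

(** Multiplying the slope by [|x + t *: y| + |x|] yields a difference of squares over [t], which is
    affine in [t]. *)
Lemma norm_mul_ndir x y : `|x| * ndir x y = form x y.
Proof.
have lhs : slope x y t * (`|x + t *: y| + `|x|) @[t --> (0 : R)^'+] -->
    ndir x y * (`|x| + `|x|).
  apply: cvgM (@slope_cvg _ _ x y) _; apply: cvgD; last exact: cvg_cst.
  by apply: cvg_norm; exact: (@cvg_addZ_at_right _ _ x y).
have rhs : 2 * form x y + t * `|y| ^+ 2 @[t --> (0 : R)^'+] --> 2 * form x y.
  rewrite -[X in _ --> X]addr0 -[X in _ --> _ + X](mul0r (`|y| ^+ 2)).
  apply: cvg_at_right_filter.
  by apply: cvgD; [exact: cvg_cst|apply: cvgM; [exact: cvg_id|exact: cvg_cst]].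
have eq s : 0 < s -> slope x y s * (`|x + s *: y| + `|x|) =
    2 * form x y + s * `|y| ^+ 2.
  move=> s0; rewrite /slope mulrAC -subr_sqr form_norm_add; field.
  by rewrite gt_eqF.
suff : ndir x y * (`|x| + `|x|) = 2 * form x y by lra.
have pos : \forall s \near (0 : R)^'+, 0 < s by exact: nbhs_right_gt.
apply/eqP; rewrite eq_le; apply/andP; split.
  by apply: (ler_cvg_to lhs rhs); near=> s; rewrite eq //; near: s.
by apply: (ler_cvg_to rhs lhs); near=> s; rewrite eq //; near: s.
Unshelve. all: by end_near. Qed.

Lemma rho_form x y : rho x y = form x y.
Proof. by rewrite rhoE mulrCA mulrBr !norm_mul_ndir linearN /=; lra. Qed.

Lemma inner_product_rho_symmetric : rho_symmetric X.
Proof. by move=> x y; rewrite /rho_orthogonal !rho_form formC. Qed.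

End inner_product.

(** * Completeness in dimension 2 *)

Section banach.
Context {R : realType} {X : normedModType R}.
Hypothesis rhoS : rho_symmetric X.
Implicit Types (x y : X).

(** The functional is linear and Lipschitz with constant [|x|^-1], so it preserves Cauchy
    filters. *)
Lemma rho_coord_cvg x (F : set_system X) : x != 0 -> ProperFilter F ->
  cauchy F -> cvg ((fun y => rho x y / `|x| ^+ 2) @ F).
Proof.
move=> x0 FF /cauchyP Fc; apply: R_complete; apply: cauchy_exP => eps eps0.
have nx : 0 < `|x| by rewrite normr_gt0.
have [y Fy] := Fc _ (mulr_gt0 eps0 nx).
exists (rho x y / `|x| ^+ 2).
suff : F [set z | `|rho x y / `|x| ^+ 2 - rho x z / `|x| ^+ 2| < eps] by [].
apply: filterS Fy => z; rewrite -ball_normE /= => yz.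
rewrite -mulrBl -rhoNr -rhoDr //.
rewrite normrM [X in _ * X]ger0_norm ?invr_ge0 // ltr_pdivrMr ?exprn_gt0 //.
by apply: le_lt_trans (rho_norm_le _ _) _; rewrite expr2 mulrA mulrC ltr_pM2r.
Qed.

(** Gram-Schmidt replaces [e 1] by [d] with [rho (e 0) d = 0]; by symmetry [rho d (e 0) = 0] as
    well, so [rho] computes both coordinates. *)
Lemma dim2_banach : has_dim X 2 -> is_banach X.
Proof.
move=> [e [e_free e_span]] F FF Fc.
have sum2 (a : 'I_2 -> R) : \sum_i a i *: e i = a 0 *: e 0 + a 1 *: e 1.
  by rewrite big_ord_recl big_ord1 (_ : lift _ _ = 1) //; exact/val_inj.
have e0 : e 0 != 0.
  apply/eqP => e0; have := e_free (fun i => (i == 0)%:R).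
  rewrite sum2 /= scale1r scale0r addr0 => /(_ e0 0) /eqP.
  by rewrite oner_eq0.
have n0 : `|e 0| != 0 by rewrite normr_eq0.
have [d [c [d0 ed dE]]] : exists d, exists c,
    [/\ d != 0, rho (e 0) d = 0 & e 1 = d + c *: e 0].
  pose c := rho (e 0) (e 1) / `|e 0| ^+ 2; exists (e 1 - c *: e 0), c.
  split; last by rewrite subrK.
    apply/eqP => d0; have := e_free (fun i => if i == 0 then - c else 1).
    rewrite sum2 /= scale1r scaleNr addrC d0 => /(_ erefl 1) /eqP.
    by rewrite /= oner_eq0.
  by rewrite -scaleNr rhoDself /c; field.
have zE z : z = (rho (e 0) z / `|e 0| ^+ 2) *: e 0 + (rho d z / `|d| ^+ 2) *: d.
  have [a ->] := e_span z; rewrite sum2.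
  rewrite dE !rhoDr // !rhoZr !rhoDr // !rhoZr ed (rhoS ed) !rhoxx.
  by lincomb (e 0) d d; field; rewrite ?normr_eq0 ?d0 ?e0.
have /cvg_ex[l1 h1] := rho_coord_cvg e0 FF Fc.
have /cvg_ex[l2 h2] := rho_coord_cvg d0 FF Fc.
apply: (cvgP (l1 *: e 0 + l2 *: d)).
have : (rho (e 0) z / `|e 0| ^+ 2) *: e 0 + (rho d z / `|d| ^+ 2) *: d
    @[z --> F] --> l1 *: e 0 + l2 *: d.
  by apply: cvgD; apply: cvgZr_tmp.
by under eq_fun do rewrite -zE.
Qed.

End banach.

Theorem theorem3p2 (R : realType) (X : normedModType R) :
  (has_dim X 2 -> rho_symmetric X -> radon_plane X) /\
  (dim_ge X 3 -> (rho_symmetric X <-> is_inner_product_space X)).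
Proof.
split=> [dim2 rhoS|dim3].
  by split=> //; [exact: dim2_banach|exact: rho_symmetric_BJ].
split=> [rhoS|[form norm_form]]; first exact: rho_inner_product.
exact: inner_product_rho_symmetric norm_form.
Qed.
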